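(* Fix $0<p<1$ and define $m(z)=\langle\phi,(zI-K_\infty)^{-1}\phi\rangle$. Then for every $z\in\mathbb C$ with $|z|>\|K_\infty\|+1$, $$m(z)=\frac{m(z/p)}{1-m(z/p)}+\frac{m(z/(1-p))}{\big(1-m(z/p)\big)\big(1-m(z/p)-m(z/(1-p))\big)}.$$
   Context: Let $S_0(x)=x/3$, $S_2(x)=(x+2)/3$ on $[0,1]$ and let $C$ be the middle-third Cantor set. For $0<p<1$, $\mu_p$ is the unique Borel probability measure on $[0,1]$ with $\mu_p=p\,\mu_p\circ S_0^{-1}+(1-p)\,\mu_p\circ S_2^{-1}$. For words $w\in\{0,2\}^n$, $S_w=S_{w_1}\circ\cdots\circ S_{w_n}$ ($S_\varnothing=\mathrm{id}$), $C_w=S_w(C)$. Inner product $\langle f,g\rangle=\int\overline fg\,d\mu_p$; $\phi=1_C$. $K_mf=\sum_{|u|\le m}\langle1_{C_u},f\rangle1_{C_u}$ and $K_\infty=\lim_{m\to\infty}K_m$ in operator norm (this limit exists and is compact, positive, self-adjoint). *)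

(* Defs.v *)
From HB Require Import structures.
From mathcomp Require Import all_boot all_order all_algebra.
From mathcomp Require Import all_classical all_reals all_analysis.
From mathcomp Require Import complex.
Set Implicit Arguments. Unset Strict Implicit. Unset Printing Implicit Defensive.
Import Order.TTheory GRing.Theory Num.Theory.
Local Open Scope classical_set_scope.
Local Open Scope ring_scope.
Local Open Scope complex_scope.

Section CantorDefs.
Variable R : realType.
Local Notation C := R[i].

Definition cmod (z : C) : R := Num.sqrt (complex.Re z ^+ 2 + complex.Im z ^+ 2).

Definition S0 (x : R) : R := x / 3.
Definition S2 (x : R) : R := (x + 2) / 3.

Definition Sletter (b : bool) : R -> R := if b then S2 else S0.

Fixpoint Sw (w : seq bool) : R -> R :=
  match w with
  | [::] => id
  | b :: w' => Sletter b \o Sw w'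
  end.

Fixpoint words (n : nat) : seq (seq bool) :=
  match n with
  | 0 => [:: [::]]
  | n'.+1 => [seq b :: w | b <- [:: false; true], w <- words n']
  end.
Definition words_le (m : nat) : seq (seq bool) :=
  flatten [seq words n | n <- iota 0 m.+1].

Definition cantor : set R :=
  [set x | forall n : nat, exists2 w, size w = n & (Sw w @` `[0, 1]%classic) x].

Definition cantor_w (w : seq bool) : set R := Sw w @` cantor.

Definition cind (A : set R) : R -> C := fun x => if `[< A x >] then 1 else 0.

Definition phi : R -> C := cind cantor.

Variable mu : {measure set R -> \bar R}.

Definition cinner (f g : R -> C) : C :=
  (Rintegral mu setT (fun x => complex.Re ((f x)^* * g x)))
  +i* (Rintegral mu setT (fun x => complex.Im ((f x)^* * g x))).

Definition isL2 (f : R -> C) : Prop :=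
  [/\ measurable_fun setT (fun x => complex.Re (f x)),
      measurable_fun setT (fun x => complex.Im (f x)) &
      mu.-integrable setT (fun x => ((complex.Re (f x)) ^+ 2 + (complex.Im (f x)) ^+ 2)%:E)].

Definition l2norm (f : R -> C) : R := Num.sqrt (complex.Re (cinner f f)).

Definition opnorm (T : (R -> C) -> (R -> C)) : \bar R :=
  ereal_sup [set (l2norm (T f))%:E | f in [set f | isL2 f /\ l2norm f <= 1]].

Definition Km (m : nat) (f : R -> C) : R -> C :=
  fun x => \sum_(u <- words_le m) cinner (cind (cantor_w u)) f * cind (cantor_w u) x.

(* g represents (zI - K)^{-1} phi in L^2(mu) *)
Definition resolvent_sol (K : (R -> C) -> (R -> C)) (z : C) (g : R -> C) : Prop :=
  isL2 g /\ {ae mu, forall x, z * g x - K g x = phi x}.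

End CantorDefs.

(* Main.v *)
(* Since [1_{C_{bu}} = 1_{C_u} o S_b^{-1}] and [mu] has weight [q_b] on [C_b], the
   operator [K] satisfies, almost everywhere,
     [(K f) o S_b = <phi, f> phi + q_b K (f o S_b)];
   this holds exactly for [K_{m+1}] on the left and [K_m] on the right, hence
   for the norm limit. If [z g - K g = phi], then
   [(z / q_b - K) (g o S_b) = (1 + m(z)) / q_b * phi], so by uniqueness of the
   resolvent [q_b <phi, g o S_b> = (1 + m(z)) m(z / q_b)]. Summing over [b] gives
   [m(z) = (1 + m(z)) (m(z/p) + m(z/(1-p)))], i.e.
   [(1 + m(z)) (1 - m(z/p) - m(z/(1-p))) = 1], which is the claimed identity
   because [|m(z/p)| < 1]. *)
Require Import Defs.
From HB Require Import structures.
From mathcomp Require Import all_boot all_order all_algebra.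
From mathcomp Require Import all_classical all_reals all_analysis.
From mathcomp Require Import complex measurable_realfun.
From mathcomp Require Import ring lra.
Set Implicit Arguments. Unset Strict Implicit. Unset Printing Implicit Defensive.
Import Order.TTheory GRing.Theory Num.Theory.
Import numFieldNormedType.Exports.
Local Open Scope classical_set_scope.
Local Open Scope ring_scope.
Local Open Scope complex_scope.

(** * Squared modulus of complex numbers *)

Section ComplexModulus.
Context {R : realType}.
Implicit Types a b z : R[i].

(** Elements of L^2 are functions rather than classes, so operator identities hold only almost
    everywhere, and two functions are identified by showing that their difference has [l2norm] zero.
    Completeness serves existence: without solutions of the three resolvent equations the identity
    would be vacuous. The limit in the intertwining relation rests on composition with S_b being
    bounded on L^2, which self-similarity provides. The maps S_b act on the whole line, where their
    images overlap; since [mu] lives on [0,1], the two branches are disjoint almost everywhere. The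
    +1 in the hypothesis makes every resolvent solution g have norm below 1, hence |m| < 1 at the
    points considered. The other factor, 1 - m(z/p) - m(z/(1-p)), needs no estimate: it divides
    1. *)

Definition sqmod (z : R[i]) : R := complex.Re z ^+ 2 + complex.Im z ^+ 2.

Lemma sqmod_ge0 z : 0 <= sqmod z.
Proof. by rewrite addr_ge0// sqr_ge0. Qed.

Lemma sqmodM a b : sqmod (a * b) = sqmod a * sqmod b.
Proof. by case: a => a1 a2; case: b => b1 b2; rewrite /sqmod /=; ring. Qed.

Lemma le_norm_sqmod z (c : R) : 0 <= c -> sqmod z <= c ^+ 2 ->
  `|complex.Re z| <= c /\ `|complex.Im z| <= c.
Proof.
have le_sqr (x : R) : 0 <= c -> x ^+ 2 <= c ^+ 2 -> `|x| <= c.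
  by move=> c0; rewrite -(real_normK (num_real x)) ler_pXn2r ?nnegrE.
move=> c0 zc; split; apply: le_sqr => //; apply: le_trans zc.
  by rewrite lerDl sqr_ge0.
by rewrite lerDr sqr_ge0.
Qed.

Lemma sqmod_le z (c : R) : `|complex.Re z| <= c -> `|complex.Im z| <= c ->
  sqmod z <= 2 * c ^+ 2.
Proof.
move=> rc ic; have c0 : 0 <= c by apply: le_trans rc.
have sq (x : R) : `|x| <= c -> x ^+ 2 <= c ^+ 2.
  by move=> xc; rewrite -(real_normK (num_real x)) ler_pXn2r ?nnegrE.
by rewrite mulr_natl mulr2n lerD// sq.
Qed.

Lemma sqmod_eq0 z : sqmod z = 0 -> z = 0.
Proof.
move=> /eqP; rewrite /sqmod paddr_eq0 ?sqr_ge0// !sqrf_eq0.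
by case: z => a b /= /andP[/eqP-> /eqP->].
Qed.

Lemma sqr_cmod z : cmod z ^+ 2 = sqmod z.
Proof. by rewrite sqr_sqrtr// sqmod_ge0. Qed.

Lemma cmod_ge0 z : 0 <= cmod z.
Proof. exact: sqrtr_ge0. Qed.

Lemma cmodM a b : cmod (a * b) = cmod a * cmod b.
Proof. by rewrite /cmod -[X in Num.sqrt X]/(sqmod _) sqmodM sqrtrM// sqmod_ge0. Qed.

Lemma cmod_real (x : R) : 0 <= x -> cmod x%:C = x.
Proof. by move=> x0; rewrite /cmod/= expr0n addr0 sqrtr_sqr ger0_norm. Qed.

Lemma cmod1 : cmod (1 : R[i]) = 1.
Proof. exact: (cmod_real ler01). Qed.

(** The difference of the two sides is |t a - b|^2 / t. The free weight [t] is what later yields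
    Minkowski's inequality without Cauchy-Schwarz. *)
Lemma sqmodD_le (t : R) a b : 0 < t ->
  sqmod (a + b) <= (1 + t) * sqmod a + (1 + t^-1) * sqmod b.
Proof.
move=> t0; rewrite -subr_ge0.
have -> : (1 + t) * sqmod a + (1 + t^-1) * sqmod b - sqmod (a + b) =
    t^-1 * ((t * complex.Re a - complex.Re b) ^+ 2 +
            (t * complex.Im a - complex.Im b) ^+ 2).
  case: a => a1 a2; case: b => b1 b2; rewrite /sqmod/=; field.
  exact: lt0r_neq0.
by rewrite mulr_ge0 ?invr_ge0 ?(ltW t0)// addr_ge0// sqr_ge0.
Qed.

End ComplexModulus.

(** * The seminormed space of square-integrable complex functions *)

Section L2Space.
Context {R : realType} (mu : {measure set R -> \bar R}).
Implicit Types f g h : R -> R[i].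

Definition cmeasurable f :=
  measurable_fun setT (fun x => complex.Re (f x)) /\
  measurable_fun setT (fun x => complex.Im (f x)).

Lemma cmeasurable_sqmod f : cmeasurable f ->
  measurable_fun setT (fun x => (sqmod (f x))%:E).
Proof.
case=> mr mi; apply/measurable_EFinP.
by apply: measurable_funD; apply: measurable_funX.
Qed.

Lemma cmeasurable_cst a : cmeasurable (fun=> a).
Proof. by split; exact: measurable_cst. Qed.

Lemma cmeasurableD f g : cmeasurable f -> cmeasurable g ->
  cmeasurable (fun x => f x + g x).
Proof.
move=> [fr fi] [gr gi]; split.
  rewrite (_ : (fun _ => _) =
      (fun x => complex.Re (f x)) \+ (fun x => complex.Re (g x))); last first.
    by apply/funext => x /=; case: (f x); case: (g x).
  exact: measurable_funD.
rewrite (_ : (fun _ => _) =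
      (fun x => complex.Im (f x)) \+ (fun x => complex.Im (g x))); last first.
  by apply/funext => x /=; case: (f x); case: (g x).
exact: measurable_funD.
Qed.

Lemma cmeasurableM f g : cmeasurable f -> cmeasurable g ->
  cmeasurable (fun x => f x * g x).
Proof.
move=> [fr fi] [gr gi]; split.
  rewrite (_ : (fun _ => _) =
    (fun x => complex.Re (f x)) \* (fun x => complex.Re (g x)) \-
    (fun x => complex.Im (f x)) \* (fun x => complex.Im (g x))); last first.
    by apply/funext => x /=; case: (f x); case: (g x).
  by apply: measurable_funB; apply: measurable_funM.
rewrite (_ : (fun _ => _) =
    (fun x => complex.Re (f x)) \* (fun x => complex.Im (g x)) \+
    (fun x => complex.Im (f x)) \* (fun x => complex.Re (g x))); last first.
  by apply/funext => x /=; case: (f x); case: (g x).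
by apply: measurable_funD; apply: measurable_funM.
Qed.

Lemma cmeasurableZ a f : cmeasurable f -> cmeasurable (fun x => a * f x).
Proof. by apply: cmeasurableM; exact: cmeasurable_cst. Qed.

Lemma cmeasurable_cind (A : set R) : measurable A -> cmeasurable (cind A).
Proof.
move=> mA; split.
  rewrite (_ : (fun _ => _) = \1_A); first exact: measurable_indic.
  apply/funext => x; rewrite /cind indicE; case: asboolP => [/mem_set->//|Ax].
  by rewrite memNset.
rewrite (_ : (fun _ => _) = cst 0); first exact: measurable_cst.
by apply/funext => x; rewrite /cind /=; case: ifP.
Qed.

Lemma isL2P f : isL2 mu f <->
  cmeasurable f /\ (\int[mu]_x (sqmod (f x))%:E < +oo)%E.
Proof.
have eqi : (\int[mu]_x `|(sqmod (f x))%:E| = \int[mu]_x (sqmod (f x))%:E)%E.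
  by apply: eq_integral => x _; rewrite gee0_abs// lee_fin sqmod_ge0.
split=> [[mr mi /integrableP[_ foo]]|[[mr mi] foo]].
  by split => //; rewrite -eqi.
split => //; apply/integrableP; split; last by rewrite -eqi in foo.
exact: cmeasurable_sqmod.
Qed.

Lemma isL2_cmeasurable f : isL2 mu f -> cmeasurable f.
Proof. by move=> /isL2P[]. Qed.

Lemma l2norm_ge0 f : 0 <= l2norm mu f.
Proof. exact: sqrtr_ge0. Qed.

Lemma l2normE f : l2norm mu f = Num.sqrt (fine (\int[mu]_x (sqmod (f x))%:E)%E).
Proof.
rewrite /l2norm /cinner /Rintegral /=; congr (Num.sqrt (fine _)).
apply: eq_integral => x _; congr EFin.
by rewrite /sqmod; case: (f x) => a b /=; ring.
Qed.

Lemma l2norm_sqr f : isL2 mu f ->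
  (\int[mu]_x (sqmod (f x))%:E)%E = (l2norm mu f ^+ 2)%:E.
Proof.
move=> /isL2P[mf foo].
have i0 : (0 <= \int[mu]_x (sqmod (f x))%:E)%E.
  by apply: integral_ge0 => x _; rewrite lee_fin sqmod_ge0.
by rewrite l2normE sqr_sqrtr ?fine_ge0// fineK// ge0_fin_numE.
Qed.

Lemma l2norm_le f (c : R) : cmeasurable f -> 0 <= c ->
  (\int[mu]_x (sqmod (f x))%:E <= (c ^+ 2)%:E)%E ->
  isL2 mu f /\ l2norm mu f <= c.
Proof.
move=> mf c0 le; have L2f : isL2 mu f.
  by apply/isL2P; split => //; apply: le_lt_trans le _; rewrite ltry.
split => //; rewrite -(@ler_pXn2r _ 2)// ?nnegrE ?l2norm_ge0//.
by rewrite -lee_fin -l2norm_sqr.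
Qed.

Lemma l2norm_ae f g : cmeasurable f -> cmeasurable g ->
  {ae mu, forall x, f x = g x} -> l2norm mu f = l2norm mu g.
Proof.
move=> mf mg fg; rewrite !l2normE; congr (Num.sqrt (fine _)).
apply: ge0_ae_eq_integral => //.
- exact: cmeasurable_sqmod.
- exact: cmeasurable_sqmod.
- by move=> x _; rewrite lee_fin sqmod_ge0.
- by move=> x _; rewrite lee_fin sqmod_ge0.
- by move: fg; apply: filterS => x -> _.
Qed.

Lemma l2norm_eq0 f : isL2 mu f -> l2norm mu f = 0 ->
  {ae mu, forall x, f x = 0}.
Proof.
move=> L2f f0; have := l2norm_sqr L2f; rewrite f0 expr0n/= => i0.
have mf : measurable_fun setT (fun x => (sqmod (f x))%:E).
  by apply: cmeasurable_sqmod; exact: isL2_cmeasurable.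
have : (\int[mu]_x `|(sqmod (f x))%:E| = 0)%E.
  by rewrite -[RHS]i0; apply: eq_integral => x _; rewrite gee0_abs// lee_fin sqmod_ge0.
move/(ae_eq_integral_abs mu measurableT mf).1.
by apply: filterS => x /(_ I) /= [] /sqmod_eq0.
Qed.

Lemma l2normD_wgt (t : R) f g : 0 < t -> isL2 mu f -> isL2 mu g ->
  (\int[mu]_x (sqmod (f x + g x))%:E <=
   ((1 + t) * l2norm mu f ^+ 2 + (1 + t^-1) * l2norm mu g ^+ 2)%:E)%E.
Proof.
move=> t0 Lf Lg; rewrite EFinD (EFinM (1 + t)) (EFinM (1 + t^-1)) -!l2norm_sqr//.
have mf := isL2_cmeasurable Lf; have mg := isL2_cmeasurable Lg.
have m1 : measurable_fun setT (fun x => (sqmod (f x))%:E).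
  exact: cmeasurable_sqmod.
have m2 : measurable_fun setT (fun x => (sqmod (g x))%:E).
  exact: cmeasurable_sqmod.
have t1 : 0 <= 1 + t by rewrite addr_ge0// ltW.
have t2 : 0 <= 1 + t^-1 by rewrite addr_ge0// invr_ge0 ltW.
have p1 x : setT x -> (0 <= (sqmod (f x))%:E)%E by rewrite lee_fin sqmod_ge0.
have p2 x : setT x -> (0 <= (sqmod (g x))%:E)%E by rewrite lee_fin sqmod_ge0.
rewrite -!ge0_integralZl_EFin//.
rewrite -ge0_integralD//; first last.
- exact: measurable_funeM.
- by move=> x xT; rewrite mule_ge0 ?p2.
- exact: measurable_funeM.
- by move=> x xT; rewrite mule_ge0 ?p1.
apply: ge0_le_integral => //.
- by move=> x _; rewrite lee_fin sqmod_ge0.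
- by apply: cmeasurable_sqmod; exact: cmeasurableD.
- by apply: emeasurable_funD; exact: measurable_funeM.
- by move=> x _; rewrite -!EFinM -EFinD lee_fin sqmodD_le.
Qed.

Lemma isL2D f g : isL2 mu f -> isL2 mu g -> isL2 mu (fun x => f x + g x).
Proof.
move=> Lf Lg; apply/isL2P; split.
  by apply: cmeasurableD; exact: isL2_cmeasurable.
by apply: le_lt_trans (l2normD_wgt ltr01 Lf Lg) _; rewrite ltry.
Qed.

(** Optimising the weighted inequality over [t]: at t = b/a its right side is (a + b)^2. The norms
    are enlarged by e/2 so that the quotient makes sense even when one of them vanishes. *)
Lemma l2normD f g : isL2 mu f -> isL2 mu g ->
  l2norm mu (fun x => f x + g x) <= l2norm mu f + l2norm mu g.
Proof.
move=> Lf Lg; have Lfg := isL2D Lf Lg.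
apply/ler_addgt0Pr => e e0.
pose a := l2norm mu f + e / 2; pose b := l2norm mu g + e / 2.
have e2 : 0 < e / 2 by rewrite divr_gt0.
have a0 : 0 < a by rewrite ltr_wpDl// l2norm_ge0.
have b0 : 0 < b by rewrite ltr_wpDl// l2norm_ge0.
have t0 : 0 < b / a by rewrite divr_gt0.
have -> : l2norm mu f + l2norm mu g + e = a + b by rewrite /a /b; field.
have ab0 : 0 <= a + b by rewrite addr_ge0// ltW.
rewrite -(@ler_pXn2r _ 2)// ?nnegrE ?l2norm_ge0//.
have := l2normD_wgt t0 Lf Lg.
rewrite l2norm_sqr// lee_fin => h. apply: (le_trans h).
have -> : (a + b) ^+ 2 = (1 + b / a) * a ^+ 2 + (1 + (b / a)^-1) * b ^+ 2.
  by field; rewrite !lt0r_neq0.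
have t1 : 0 <= 1 + b / a by rewrite addr_ge0// ltW.
have t2 : 0 <= 1 + (b / a)^-1 by rewrite addr_ge0// invr_ge0 ltW.
have fa : l2norm mu f ^+ 2 <= a ^+ 2.
  by rewrite ler_pXn2r ?nnegrE ?l2norm_ge0 ?(ltW a0)// lerDl ltW.
have gb : l2norm mu g ^+ 2 <= b ^+ 2.
  by rewrite ler_pXn2r ?nnegrE ?l2norm_ge0 ?(ltW b0)// lerDl ltW.
by rewrite lerD// ler_wpM2l.
Qed.

Lemma isL2Z a f : isL2 mu f -> isL2 mu (fun x => a * f x).
Proof.
move=> Lf; have mf := isL2_cmeasurable Lf.
apply/isL2P; split; first exact: cmeasurableZ.
under eq_integral do rewrite sqmodM EFinM.
rewrite ge0_integralZl_EFin ?sqmod_ge0//.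
- by rewrite l2norm_sqr// -EFinM ltry.
- by move=> x _; rewrite lee_fin sqmod_ge0.
- exact: cmeasurable_sqmod.
Qed.

Lemma l2normZ a f : isL2 mu f ->
  l2norm mu (fun x => a * f x) = cmod a * l2norm mu f.
Proof.
move=> Lf; have mf := isL2_cmeasurable Lf.
rewrite l2normE; under eq_integral do rewrite sqmodM EFinM.
rewrite ge0_integralZl_EFin ?sqmod_ge0//.
- rewrite l2norm_sqr// -EFinM/= -sqr_cmod -exprMn sqrtr_sqr ger0_norm//.
  by rewrite mulr_ge0// ?cmod_ge0 ?l2norm_ge0.
- by move=> x _; rewrite lee_fin sqmod_ge0.
- exact: cmeasurable_sqmod.
Qed.

Lemma isL2_0 : isL2 mu (fun=> 0).
Proof.
apply/isL2P; split; first exact: cmeasurable_cst.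
by rewrite integral0_eq// => x _; rewrite /sqmod/= expr0n addr0.
Qed.

Lemma isL2_lin a f g : isL2 mu f -> isL2 mu g ->
  isL2 mu (fun x => a * f x + g x).
Proof. by move=> Lf Lg; apply: isL2D => //; exact: isL2Z. Qed.

Lemma isL2B f g : isL2 mu f -> isL2 mu g -> isL2 mu (fun x => f x - g x).
Proof.
move=> Lf Lg; have := isL2_lin (-1) Lg Lf.
by congr isL2; apply/funext => x; rewrite mulN1r addrC.
Qed.

Lemma isL2_sum {I : Type} (s : seq I) (F : I -> R -> R[i]) :
  (forall i, isL2 mu (F i)) -> isL2 mu (fun x => \sum_(i <- s) F i x).
Proof.
move=> LF; elim: s => [|i s ih].
  by under eq_fun do rewrite big_nil; exact: isL2_0.
by under eq_fun do rewrite big_cons; exact: isL2D.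
Qed.

Lemma l2norm0 : l2norm mu (fun=> 0) = 0.
Proof.
have := l2normZ 0 isL2_0; under eq_fun do rewrite mul0r.
by move->; rewrite /cmod/= expr0n addr0 sqrtr0 mul0r.
Qed.

End L2Space.

(** * Real sequences with geometrically small increments *)

Section GeometricSequences.
Context {R : realType}.

Lemma geometric_increments_cvg (u : R^nat) (C s : R) : 0 <= C -> 0 <= s < 1 ->
  (forall n, `|u n.+1 - u n| <= C * s ^+ n) ->
  cvgn u /\ forall n, `|limn u - u n| <= C * s ^+ n / (1 - s).
Proof.
move=> C0 /andP[s0 s1] du.
have s10 : 0 < 1 - s by rewrite subr_gt0.
have cu : cvgn u.
  have : cvgn (series (fun n => u n.+1 - u n)).
    apply: normed_cvg; apply: (@series_le_cvg _ _ (geometric C s)).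
    - by move=> n /=.
    - by move=> n; rewrite /geometric/= mulr_ge0// exprn_ge0.
    - exact: du.
    - by apply: is_cvg_geometric_series; rewrite ger0_norm.
  have -> : series (fun n => u n.+1 - u n) = (fun n => u n - u 0%N).
    by apply/funext => n; rewrite /series/= telescope_sumr.
  move=> cvu; have -> : u = (fun n => u n - u 0%N) \+ cst (u 0%N).
    by apply/funext => n /=; rewrite subrK.
  by apply: is_cvgD => //; exact: is_cvg_cst.
split => // n.
have bd k : `|u (n + k)%N - u n| <= C * s ^+ n / (1 - s).
  (* The finite geometric sum is kept exactly so that the induction on [k] closes; the factor 1 -
     s^k is dropped afterwards. *)
  suff : `|u (n + k)%N - u n| <= C * s ^+ n * (1 - s ^+ k) / (1 - s).
    move=> h; apply: (le_trans h); rewrite ler_wpM2r ?invr_ge0 ?(ltW s10)//.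
    by rewrite ler_piMr ?mulr_ge0 ?exprn_ge0// gerBl exprn_ge0.
  elim: k => [|k ih]; first by rewrite addn0 subrr normr0 expr0 subrr mulr0 mul0r.
  have -> : u (n + k.+1)%N - u n =
      (u (n + k).+1 - u (n + k)%N) + (u (n + k)%N - u n).
    by rewrite addnS; ring.
  apply: (le_trans (ler_normD _ _)); apply: (le_trans (lerD (du _) ih)).
  rewrite exprD exprS le_eqVlt; apply/orP; left; apply/eqP; field.
  exact: lt0r_neq0.
have cv : (fun k => `|u (k + n)%N - u n|) @ \oo --> `|limn u - u n|.
  by apply: cvg_norm; apply: cvgB; [rewrite cvg_shiftn|exact: cvg_cst].
have <- := cvg_lim (@Rhausdorff R) cv.
apply: limr_le; first by apply/cvg_ex; eexists; exact: cv.
by apply: nearW => k; rewrite addnC.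
Qed.

Lemma nneseries_geometric_lty (C q : R) : 0 <= C -> 0 <= q < 1 ->
  (\sum_(n <oo) (C * q ^+ n)%:E < +oo)%E.
Proof.
move=> C0 /andP[q0 q1].
have -> : (\sum_(n <oo) (C * q ^+ n)%:E)%E = (limn (series (geometric C q)))%:E.
  rewrite -EFin_lim; last by apply: is_cvg_geometric_series; rewrite ger0_norm.
  by congr (limn _); apply/funext => n; rewrite /= /series/= sumEFin.
by rewrite ltry.
Qed.

End GeometricSequences.

(** * Completeness of L^2 for geometrically Cauchy sequences *)

Section L2Completeness.
Context {R : realType} (mu : {measure set R -> \bar R}).
Variables (G : nat -> R -> R[i]) (c r : R).
Hypotheses (LG : forall n, isL2 mu (G n)) (c0 : 0 <= c) (r01 : 0 <= r < 1).
Hypothesis dG : forall n, l2norm mu (fun x => G n.+1 x - G n x) <= c * r ^+ n.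

(** A rate strictly between [r] and 1. That r < s makes the weighted increments summable in L^1,
    their integrals being at most c^2 (r/s)^(2n); that s < 1 makes the pointwise increments
    geometric. *)
Let s := (r + 1) / 2.

Let s_gt0 : 0 < s.
Proof. by move: r01 => /andP[? ?]; rewrite /s divr_gt0// ltr_wpDl. Qed.

Let s_lt1 : s < 1.
Proof. by move: r01 => /andP[? ?]; rewrite /s ltr_pdivrMr// mul1r ltrD2r. Qed.

Let r_lt_s : r < s.
Proof. by move: r01 => /andP[? ?]; rewrite /s ltr_pdivlMr// mulr_natr mulr2n ltrD2l. Qed.

Let wgt n x : \bar R := (((s ^+ n) ^- 2) * sqmod (G n.+1 x - G n x))%:E.

Let wgt_ge0 n x : (0 <= wgt n x)%E.
Proof. by rewrite lee_fin mulr_ge0 ?sqmod_ge0// invr_ge0 sqr_ge0. Qed.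

Let mwgt n : measurable_fun setT (wgt n).
Proof.
rewrite /wgt; under eq_fun do rewrite EFinM.
apply: measurable_funeM; apply: cmeasurable_sqmod.
by apply: isL2_cmeasurable (isL2B (LG _) (LG _)).
Qed.

(* By Tonelli [H] is integrable, hence finite almost everywhere; where it is
   finite, [|G n.+1 - G n| <= sqrt H * s ^+ n], so that [G] converges there. *)
Let H x : \bar R := (\sum_(n <oo) wgt n x)%E.

Let mH : measurable_fun setT H.
Proof. by apply: ge0_emeasurable_sum => // n x _ _; exact: wgt_ge0. Qed.

Let H_ge0 x : (0 <= H x)%E.
Proof. by apply: nneseries_ge0 => n _ _; exact: wgt_ge0. Qed.

Let int_wgt n : (\int[mu]_x wgt n x <= (c ^+ 2 * ((r / s) ^+ 2) ^+ n)%:E)%E.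
Proof.
rewrite /wgt; under eq_integral do rewrite EFinM.
have L := isL2B (LG n.+1) (LG n).
rewrite ge0_integralZl_EFin//; last 3 first.
- by move=> x _; rewrite lee_fin sqmod_ge0.
- by apply: cmeasurable_sqmod; exact: isL2_cmeasurable L.
- by rewrite invr_ge0 sqr_ge0.
rewrite l2norm_sqr// -EFinM lee_fin.
have -> : c ^+ 2 * ((r / s) ^+ 2) ^+ n = (s ^+ n) ^- 2 * (c * r ^+ n) ^+ 2.
  by rewrite exprAC expr_div_n; field; rewrite expf_neq0// lt0r_neq0.
rewrite ler_wpM2l ?invr_ge0 ?sqr_ge0// ler_pXn2r ?nnegrE ?l2norm_ge0//.
by move: r01 => /andP[? ?]; rewrite mulr_ge0// exprn_ge0.
Qed.

Let int_H : (\int[mu]_x H x < +oo)%E.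
Proof.
rewrite /H integral_nneseries//.
apply: (@le_lt_trans _ _ (\sum_(n <oo) (c ^+ 2 * ((r / s) ^+ 2) ^+ n)%:E)%E).
  apply: lee_nneseries => n _; last exact: int_wgt.
  by move=> _; apply: integral_ge0.
move: r01 => /andP[r0 r1]; apply: nneseries_geometric_lty.
  exact: sqr_ge0.
rewrite sqr_ge0/= expr_lt1//; first by rewrite ltr_pdivrMr// mul1r.
by rewrite divr_ge0// ltW.
Qed.

Let A := [set x | (H x < +oo)%E].

Let mA : measurable A.
Proof. by rewrite -[A]setTI; exact: emeasurable_fun_infty_o. Qed.

Let h x := fine (H x).

Let h_ge0 x : 0 <= h x. Proof. exact: fine_ge0. Qed.

Let mh : measurable_fun setT (EFin \o h).
Proof. by apply/measurable_EFinP; exact: measurableT_comp. Qed.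

Let int_h : (\int[mu]_x (h x)%:E < +oo)%E.
Proof.
apply: le_lt_trans int_H; apply: ge0_le_integral => //.
  by move=> x _; rewrite lee_fin.
by move=> x _; rewrite /h; have := H_ge0 x; case: (H x).
Qed.

Let ae_A : {ae mu, forall x, A x}.
Proof.
have : mu.-integrable setT H.
  apply/integrableP; split => //.
  by under eq_integral do rewrite gee0_abs//.
move=> /(integrable_ae measurableT); apply: filterS => x /(_ I).
by rewrite /A /= ge0_fin_numE.
Qed.

(** Cutting off outside [A] makes the sequence converge everywhere, so the limit is measurable as an
    everywhere limit. Where H is infinite, [h] takes the value 0 and all [G' n] vanish, so the
    pointwise estimates hold there too. *)
Let G' n x := cind A x * G n x.

Let G'E n x : A x -> G' n x = G n x.
Proof. by move=> Ax; rewrite /G' /cind asboolT// mul1r. Qed.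

Let mG' n : cmeasurable (G' n).
Proof.
by apply: cmeasurableM (cmeasurable_cind mA) (isL2_cmeasurable (LG n)).
Qed.

Let dG'_le n x : sqmod (G' n.+1 x - G' n x) <= (Num.sqrt (h x) * s ^+ n) ^+ 2.
Proof.
have [Ax|nAx] := pselect (A x); last first.
  rewrite /G' /cind asboolF// !mul0r subrr /sqmod /= expr0n /= addr0.
  exact: sqr_ge0.
rewrite !G'E//.
have : (wgt n x <= H x)%E.
  have := @nneseries_lim_ge R (wgt ^~ x) xpredT 0%N n.+1 (fun k _ _ => wgt_ge0 k x).
  apply: le_trans; rewrite big_nat_recr//=; apply: leeDr.
  by apply: sume_ge0 => k _; exact: wgt_ge0.
have -> : H x = (h x)%:E by rewrite /h fineK// ge0_fin_numE.
rewrite lee_fin ler_pdivrMl ?exprn_gt0//.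
move=> le; apply: (le_trans le).
by rewrite (exprMn _ (Num.sqrt _)) sqr_sqrtr// mulrC.
Qed.

Let C_ge0 x : 0 <= Num.sqrt (h x). Proof. exact: sqrtr_ge0. Qed.

Let s01 : 0 <= s < 1. Proof. by rewrite s_lt1 ltW. Qed.

Let ReB (a b : R[i]) : complex.Re (a - b) = complex.Re a - complex.Re b.
Proof. by case: a; case: b. Qed.

Let ImB (a b : R[i]) : complex.Im (a - b) = complex.Im a - complex.Im b.
Proof. by case: a; case: b. Qed.

Let cvgRe x := @geometric_increments_cvg _ (fun n => complex.Re (G' n x)) _ _
  (C_ge0 x) s01.

Let cvgIm x := @geometric_increments_cvg _ (fun n => complex.Im (G' n x)) _ _
  (C_ge0 x) s01.

Let dRe x n :
  `|complex.Re (G' n.+1 x) - complex.Re (G' n x)| <= Num.sqrt (h x) * s ^+ n.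
Proof.
rewrite -ReB; apply: (le_norm_sqmod _ (dG'_le n x)).1.
by rewrite mulr_ge0// exprn_ge0// ltW.
Qed.

Let dIm x n :
  `|complex.Im (G' n.+1 x) - complex.Im (G' n x)| <= Num.sqrt (h x) * s ^+ n.
Proof.
rewrite -ImB; apply: (le_norm_sqmod _ (dG'_le n x)).2.
by rewrite mulr_ge0// exprn_ge0// ltW.
Qed.

Let g x := limn (fun n => complex.Re (G' n x)) +i*
           limn (fun n => complex.Im (G' n x)).

Let mg : cmeasurable g.
Proof.
split; rewrite /g /=.
  apply: (measurable_fun_cvg (fun n => (mG' n).1)) => x _.
  exact: (cvgRe (dRe x)).1.
apply: (measurable_fun_cvg (fun n => (mG' n).2)) => x _.
exact: (cvgIm (dIm x)).1.
Qed.

Let gG'_le n x :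
  sqmod (g x - G' n x) <= 2 * (s ^+ n / (1 - s)) ^+ 2 * h x.
Proof.
have -> : 2 * (s ^+ n / (1 - s)) ^+ 2 * h x =
    2 * (Num.sqrt (h x) * s ^+ n / (1 - s)) ^+ 2.
  by rewrite -[in LHS](sqr_sqrtr (h_ge0 x)); ring.
apply: sqmod_le; rewrite ?ReB ?ImB.
  exact: (cvgRe (dRe x)).2.
exact: (cvgIm (dIm x)).2.
Qed.

Lemma l2_geometric_cauchy_cvg : exists2 g, isL2 mu g &
  (fun n => l2norm mu (fun x => g x - G n x)) @ \oo --> (0 : R).
Proof.
have [I I0 IE] : exists2 I : R, 0 <= I & (\int[mu]_x (h x)%:E = I%:E)%E.
  have i0 : (0 <= \int[mu]_x (h x)%:E)%E.
    by apply: integral_ge0 => x _; rewrite lee_fin.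
  exists (fine (\int[mu]_x (h x)%:E)); first exact: fine_ge0.
  by rewrite fineK// ge0_fin_numE.
(* The square root of the integral of [gG'_le], without s^n; the 2 comes from estimating real and
   imaginary parts separately. *)
pose K := Num.sqrt (2 * I) / (1 - s).
have K0 : 0 <= K by rewrite divr_ge0// subr_ge0 ltW.
have key n : isL2 mu (fun x => g x - G n x) /\
             l2norm mu (fun x => g x - G n x) <= K * s ^+ n.
  have mgG (F : R -> R[i]) : cmeasurable F -> cmeasurable (fun x => g x - F x).
    move=> mF; have := cmeasurableD mg (cmeasurableZ (-1) mF).
    by congr cmeasurable; apply/funext => x; rewrite mulN1r.
  apply: l2norm_le.
  - exact: mgG (isL2_cmeasurable (LG n)).
  - by rewrite mulr_ge0// exprn_ge0// ltW.
  have -> : (\int[mu]_x (sqmod (g x - G n x))%:E =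
             \int[mu]_x (sqmod (g x - G' n x))%:E)%E.
    apply: ge0_ae_eq_integral => //.
    - exact: cmeasurable_sqmod (mgG _ (isL2_cmeasurable (LG n))).
    - exact: cmeasurable_sqmod (mgG _ (mG' n)).
    - by move=> x _; rewrite lee_fin sqmod_ge0.
    - by move=> x _; rewrite lee_fin sqmod_ge0.
    - by move: ae_A; apply: filterS => x Ax _; rewrite G'E.
  apply: (@le_trans _ _ (\int[mu]_x ((2 * (s ^+ n / (1 - s)) ^+ 2)%:E * (h x)%:E))%E).
    apply: ge0_le_integral => //.
    - by move=> x _; rewrite lee_fin sqmod_ge0.
    - exact: cmeasurable_sqmod (mgG _ (mG' n)).
    - exact: measurable_funeM.
    - by move=> x _; rewrite -EFinM lee_fin.
  rewrite ge0_integralZl_EFin//; last 2 first.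
  - by move=> x _; rewrite lee_fin.
  - by rewrite mulr_ge0// sqr_ge0.
  rewrite IE -EFinM lee_fin /K !exprMn sqr_sqrtr ?mulr_ge0//.
  by rewrite le_eqVlt; apply/orP; left; apply/eqP; ring.
exists g.
  have := isL2D (key 0%N).1 (LG 0%N); congr isL2.
  by apply/funext => x; rewrite subrK.
apply: (@squeeze_cvgr _ _ _ _ (cst 0) (fun n => K * s ^+ n)).
- by apply: nearW => n /=; rewrite l2norm_ge0 (key n).2.
- exact: cvg_cst.
- rewrite -[X in _ --> X](mulr0 K); apply: cvgMr; apply: cvg_expr.
  by rewrite ger0_norm// ltW.
Qed.

End L2Completeness.

(** * Operators on L^2 that are linear up to null sets *)

Section AlmostLinearOperators.
Context {R : realType} (mu : {measure set R -> \bar R}).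
Implicit Types (T : (R -> R[i]) -> (R -> R[i])) (f g phi : R -> R[i]).

(** Functions are not quotiented by null sets, so linearity can only be asked almost everywhere. A
    norm bound then makes [T] respect almost everywhere equality. *)
Definition ae_linear T :=
  (forall f, isL2 mu f -> isL2 mu (T f)) /\
  (forall (a : R[i]) f g, isL2 mu f -> isL2 mu g ->
     {ae mu, forall x, T (fun y => a * f y + g y) x = a * T f x + T g x}).

Lemma ae_linear0 T : ae_linear T -> {ae mu, forall x, T (fun=> 0) x = 0}.
Proof.
move=> [_ lT]; have := lT 1 _ _ (isL2_0 mu) (isL2_0 mu).
have -> : (fun _ : R => 1 * 0 + 0 : R[i]) = fun=> 0.
  by apply/funext => x; rewrite mulr0 addr0.
apply: filterS => x /eqP; rewrite mul1r -subr_eq0 opprD addrA subrr sub0r.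
by rewrite oppr_eq0 => /eqP.
Qed.

Lemma ae_linearZ T a f : ae_linear T -> isL2 mu f ->
  {ae mu, forall x, T (fun y => a * f y) x = a * T f x}.
Proof.
move=> lT Lf; have := lT.2 a _ _ Lf (isL2_0 mu).
have -> : (fun y => a * f y + 0) = fun y => a * f y.
  by apply/funext => x; rewrite addr0.
by have := ae_linear0 lT; apply: filterS2 => x -> ->; rewrite addr0.
Qed.

Lemma ae_linearB T f g : ae_linear T -> isL2 mu f -> isL2 mu g ->
  {ae mu, forall x, T (fun y => f y - g y) x = T f x - T g x}.
Proof.
move=> lT Lf Lg; have := lT.2 (-1) _ _ Lg Lf.
have -> : (fun y => -1 * g y + f y) = fun y => f y - g y.
  by apply/funext => x; rewrite mulN1r addrC.
by apply: filterS => x ->; rewrite mulN1r addrC.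
Qed.

Lemma opnorm_ge0 T : ae_linear T -> (0 <= opnorm mu T)%E.
Proof.
move=> lT; apply: (@le_trans _ _ (l2norm mu (T (fun=> 0)))%:E).
  by rewrite lee_fin l2norm_ge0.
by apply: ereal_sup_ubound; exists (fun=> 0) => //; split;
  [exact: isL2_0|rewrite l2norm0].
Qed.

(** Normalising by |f| fails when the norm is 0, so f is divided by |f| + e, which lands in the unit
    ball, and e tends to 0. The error M e is absorbed by taking e/(M + 1), where M + 1 is positive
    even if M = 0. *)
Lemma l2norm_le_opnorm T (M : R) f : ae_linear T -> (opnorm mu T <= M%:E)%E ->
  isL2 mu f -> l2norm mu (T f) <= M * l2norm mu f.
Proof.
move=> lT TM Lf.
have M0 : 0 <= M by rewrite -lee_fin; apply: le_trans TM; exact: opnorm_ge0.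
suff key (e : R) : 0 < e -> l2norm mu (T f) <= M * (l2norm mu f + e).
  apply/ler_addgt0Pr => e e0.
  have e1 : 0 < e / (M + 1) by rewrite divr_gt0// ltr_wpDl.
  apply: (le_trans (key _ e1)); rewrite mulrDr lerD2l mulrCA.
  by rewrite ler_piMr ?(ltW e0)// ler_pdivrMr ?ltr_wpDl// mul1r lerDl.
move=> e0; have d0 : 0 < l2norm mu f + e by rewrite ltr_wpDl// l2norm_ge0.
have cd : cmod (l2norm mu f + e)^-1%:C = (l2norm mu f + e)^-1.
  by rewrite cmod_real// invr_ge0 ltW.
have : l2norm mu (T (fun y => (l2norm mu f + e)^-1%:C * f y)) <= M.
  rewrite -lee_fin; apply: le_trans TM; apply: ereal_sup_ubound.
  eexists; last reflexivity; split; first exact: isL2Z.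
  by rewrite l2normZ// cd mulrC ler_pdivrMr// mul1r lerDl ltW.
have -> : l2norm mu (T (fun y => (l2norm mu f + e)^-1%:C * f y)) =
          l2norm mu (fun x => (l2norm mu f + e)^-1%:C * T f x).
  apply: l2norm_ae; last exact: ae_linearZ.
    by apply: isL2_cmeasurable (lT.1 _ (isL2Z _ Lf)).
  by apply: isL2_cmeasurable (isL2Z _ (lT.1 _ Lf)).
by rewrite l2normZ ?cd; [rewrite mulrC ler_pdivrMr|exact: lT.1].
Qed.

(** * Solving (w - T) g = phi when |w| exceeds a bound of T *)

Section Resolvent.
Variables (T : (R -> R[i]) -> (R -> R[i])) (M : R) (w : R[i]).
Hypotheses (lT : ae_linear T) (M0 : 0 <= M) (Mw : M < cmod w).
Hypothesis TM : forall f, isL2 mu f -> l2norm mu (T f) <= M * l2norm mu f.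

(** Triangle inequality in w g = phi + T g. It serves twice: with phi = 0 as uniqueness of the
    resolvent, and with the indicator of the Cantor set to bound m. *)
Lemma resolvent_bound phi g : isL2 mu phi -> isL2 mu g ->
  {ae mu, forall x, w * g x - T g x = phi x} ->
  (cmod w - M) * l2norm mu g <= l2norm mu phi.
Proof.
move=> Lphi Lg eq; rewrite mulrBl lerBlDr -l2normZ//.
have -> : l2norm mu (fun x => w * g x) = l2norm mu (fun x => phi x + T g x).
  apply: l2norm_ae.
  - exact: isL2_cmeasurable (isL2Z _ Lg).
  - exact: isL2_cmeasurable (isL2D Lphi (lT.1 _ Lg)).
  - by move: eq; apply: filterS => x <-; rewrite subrK.
apply: (le_trans (l2normD Lphi (lT.1 _ Lg))).
by rewrite lerD2l TM.
Qed.

Let w0 : 0 < cmod w. Proof. exact: le_lt_trans Mw. Qed.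

Let w_neq0 : w != 0.
Proof.
apply/eqP => w00; move: w0; rewrite w00 /cmod /= expr0n /= addr0 sqrtr0.
by rewrite ltxx.
Qed.

Let cmodV : cmod w^-1 = (cmod w)^-1.
Proof.
apply: (mulfI (lt0r_neq0 w0)).
by rewrite -cmodM (divff w_neq0) (divff (lt0r_neq0 w0)) cmod1.
Qed.

(* The affine contraction [f |-> (T f + phi) / w] has the resolvent as its
   fixed point; its iterates are the Neumann partial sums. *)
Lemma resolvent_exists phi : isL2 mu phi -> exists2 g, isL2 mu g &
  {ae mu, forall x, w * g x - T g x = phi x}.
Proof.
move=> Lphi; pose S f x := w^-1 * (T f x + phi x).
have LS f : isL2 mu f -> isL2 mu (S f).
  by move=> Lf; apply/isL2Z/isL2D => //; exact: lT.1.
have dS f g : isL2 mu f -> isL2 mu g ->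
    l2norm mu (fun x => S f x - S g x) <=
    M / cmod w * l2norm mu (fun x => f x - g x).
  move=> Lf Lg; have LB := isL2B Lf Lg.
  have -> : l2norm mu (fun x => S f x - S g x) =
            l2norm mu (fun x => w^-1 * T (fun x => f x - g x) x).
    apply: l2norm_ae.
    - exact: isL2_cmeasurable (isL2B (LS _ Lf) (LS _ Lg)).
    - exact: isL2_cmeasurable (isL2Z _ (lT.1 _ LB)).
    - have := ae_linearB lT Lf Lg; apply: filterS => x ->; rewrite /S; ring.
  rewrite l2normZ ?cmodV; last exact: lT.1.
  by rewrite [M / _]mulrC -mulrA ler_wpM2l ?invr_ge0 ?(ltW w0)// TM.
pose G n := iter n S (fun=> 0).
have LG n : isL2 mu (G n).
  by elim: n => [|n ih]; [exact: isL2_0|exact: LS].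
pose c := l2norm mu (fun x => G 1%N x - G 0%N x); pose r := M / cmod w.
have r01 : 0 <= r < 1.
  by rewrite /r divr_ge0 ?(ltW w0)// ltr_pdivrMr// mul1r.
have dG n : l2norm mu (fun x => G n.+1 x - G n x) <= c * r ^+ n.
  elim: n => [|n ih]; first by rewrite expr0 mulr1.
  apply: (le_trans (dS (G n.+1) (G n) (LG _) (LG _))).
  rewrite exprS (mulrCA c r).
  by apply: ler_wpM2l ih; case/andP: r01.
have [g Lg gG] := l2_geometric_cauchy_cvg LG (l2norm_ge0 _ _) r01 dG.
exists g => //.
have LD : isL2 mu (fun x => w * g x - T g x - phi x).
  by apply: isL2B => //; apply: isL2B; [exact: isL2Z|exact: lT.1].
suff D0 : l2norm mu (fun x => w * g x - T g x - phi x) = 0.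
  by have := l2norm_eq0 LD D0; apply: filterS => x /eqP; rewrite subr_eq0 => /eqP.
pose d n := l2norm mu (fun x => g x - G n x).
(* As w G_(n+1) = T G_n + phi, the defect of g equals w (g - G_(n+1)) - T (g - G_n), and both parts
   tend to 0. *)
have bd n : l2norm mu (fun x => w * g x - T g x - phi x) <=
    cmod w * d n.+1 + M * d n.
  have L1 := isL2B Lg (LG n.+1); have L0 := isL2B Lg (LG n).
  have -> : l2norm mu (fun x => w * g x - T g x - phi x) =
      l2norm mu (fun x => w * (g x - G n.+1 x) +
                          -1 * T (fun x => g x - G n x) x).
    apply: l2norm_ae.
    - exact: isL2_cmeasurable LD.
    - exact: isL2_cmeasurable (isL2D (isL2Z _ L1) (isL2Z _ (lT.1 _ L0))).
    - have := ae_linearB lT Lg (LG n); apply: filterS => x ->.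
      by rewrite [G n.+1 x]/(S (G n) x) /S; field.
  apply: (le_trans (l2normD (isL2Z _ L1) (isL2Z _ (lT.1 _ L0)))).
  rewrite !l2normZ//; last exact: lT.1.
  have -> : cmod (-1 : R[i]) = 1.
    by rewrite /cmod/= sqrrN expr1n oppr0 expr0n addr0 sqrtr1.
  by rewrite mul1r lerD2l TM.
apply/eqP; rewrite eq_le l2norm_ge0 andbT.
have cv : (fun n => cmod w * d n.+1 + M * d n) @ \oo --> (0 : R).
  rewrite -[X in _ --> X](_ : cmod w * 0 + M * 0 = 0); last first.
    by rewrite !mulr0 addr0.
  apply: cvgD; apply: cvgMr => //.
  by rewrite -(@cvg_shiftS _ d) in gG.
have <- := cvg_lim (@Rhausdorff R) cv.
apply: limr_ge; first by apply/cvg_ex; eexists; exact: cv.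
exact: nearW.
Qed.

End Resolvent.

End AlmostLinearOperators.

(** * The inner product and Cauchy-Schwarz *)

Section InnerProduct.
Context {R : realType} (mu : {measure set R -> \bar R}).
Implicit Types f g h : R -> R[i].

Lemma cmeasurable_conj f : cmeasurable f -> cmeasurable (fun x => (f x)^*).
Proof.
move=> [mr mi]; split.
  rewrite (_ : (fun _ => _) = (fun x => complex.Re (f x)))//.
  by apply/funext => x /=; case: (f x).
rewrite (_ : (fun _ => _) = (fun x => - complex.Im (f x))).
  exact: measurable_funN.
by apply/funext => x /=; case: (f x).
Qed.

Lemma cmeasurable_cinner f g : cmeasurable f -> cmeasurable g ->
  cmeasurable (fun x => (f x)^* * g x).
Proof. by move=> mf mg; apply: cmeasurableM => //; exact: cmeasurable_conj. Qed.

Lemma cinner_ae f f' g g' : cmeasurable f -> cmeasurable f' ->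
  cmeasurable g -> cmeasurable g' ->
  {ae mu, forall x, f x = f' x} -> {ae mu, forall x, g x = g' x} ->
  cinner mu f g = cinner mu f' g'.
Proof.
move=> mf mf' mg mg' ff' gg'.
have [mr mi] := cmeasurable_cinner mf mg.
have [mr' mi'] := cmeasurable_cinner mf' mg'.
congr (_ +i* _); congr fine; apply: ae_eq_integral => //;
  try exact/measurable_EFinP.
  by move: ff' gg'; apply: filterS2 => x -> ->.
by move: ff' gg'; apply: filterS2 => x -> ->.
Qed.

Lemma integrable_sqmod f : isL2 mu f ->
  mu.-integrable setT (fun x => (sqmod (f x))%:E).
Proof. by case. Qed.

Lemma integrable_cinner f g : isL2 mu f -> isL2 mu g ->
  mu.-integrable setT (EFin \o (fun x => complex.Re ((f x)^* * g x))) /\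
  mu.-integrable setT (EFin \o (fun x => complex.Im ((f x)^* * g x))).
Proof.
move=> Lf Lg.
have [mr mi] := cmeasurable_cinner (isL2_cmeasurable Lf) (isL2_cmeasurable Lg).
have I := integrableD measurableT (integrable_sqmod Lf) (integrable_sqmod Lg).
(* A crude bound |a b| <= |a|^2 + |b|^2, giving the integrable majorant |f|^2 + |g|^2. *)
have bd (a b : R[i]) : `|complex.Re (a^* * b)| <= sqmod a + sqmod b /\
                      `|complex.Im (a^* * b)| <= sqmod a + sqmod b.
  have s0 : 0 <= sqmod a + sqmod b by rewrite addr_ge0// sqmod_ge0.
  apply: le_norm_sqmod => //; rewrite sqmodM.
  have -> : sqmod a^* = sqmod a by case: a {s0} => a1 a2; rewrite /sqmod/=; ring.
  rewrite -subr_ge0.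
  have -> : (sqmod a + sqmod b) ^+ 2 - sqmod a * sqmod b =
    sqmod a ^+ 2 + sqmod b ^+ 2 + sqmod a * sqmod b by ring.
  by rewrite !addr_ge0// ?sqr_ge0// mulr_ge0// sqmod_ge0.
split; apply: (le_integrable measurableT _ _ I); try exact/measurable_EFinP.
  move=> x _ /=; rewrite lee_fin; apply: le_trans (ler_norm _).
  exact: (bd _ _).1.
move=> x _ /=; rewrite lee_fin; apply: le_trans (ler_norm _).
exact: (bd _ _).2.
Qed.

Lemma cinner_lin a f g h : isL2 mu f -> isL2 mu g -> isL2 mu h ->
  cinner mu f (fun x => a * g x + h x) = a * cinner mu f g + cinner mu f h.
Proof.
move=> Lf Lg Lh.
have [rg ig] := integrable_cinner Lf Lg.
have [rh ih] := integrable_cinner Lf Lh.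
have iZ (c : R) (u : R -> R) : mu.-integrable setT (EFin \o u) ->
    mu.-integrable setT (EFin \o (fun x => c * u x)).
  by move=> iu; have := integrableZl measurableT c iu; congr integrable.
rewrite /cinner; case: a => a1 a2 /=.
apply/eqP; rewrite eq_complex /=; apply/andP; split; apply/eqP.
  transitivity (Rintegral mu setT (fun x =>
    a1 * complex.Re ((f x)^* * g x) + (- a2) * complex.Im ((f x)^* * g x) +
    complex.Re ((f x)^* * h x))).
    apply: eq_Rintegral => x _.
    by case: (f x) => ? ?; case: (g x) => ? ?; case: (h x) => ? ? /=; ring.
  rewrite RintegralD//; first last.
    by have := integrableD measurableT (iZ a1 _ rg) (iZ (- a2) _ ig);
       congr integrable.
  rewrite RintegralD ?RintegralZl ?mulNr//; exact: iZ.
transitivity (Rintegral mu setT (fun x =>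
  a1 * complex.Im ((f x)^* * g x) + a2 * complex.Re ((f x)^* * g x) +
  complex.Im ((f x)^* * h x))).
  apply: eq_Rintegral => x _.
  by case: (f x) => ? ?; case: (g x) => ? ?; case: (h x) => ? ? /=; ring.
rewrite RintegralD//; first last.
  by have := integrableD measurableT (iZ a1 _ ig) (iZ a2 _ rg);
     congr integrable.
rewrite RintegralD ?RintegralZl//; exact: iZ.
Qed.

Lemma cinner0r f : cinner mu f (fun=> 0) = 0.
Proof.
by rewrite /cinner; congr (_ +i* _); rewrite /Rintegral integral0_eq// => x _;
   rewrite mulr0.
Qed.

Lemma cinnerZ a f g : isL2 mu f -> isL2 mu g ->
  cinner mu f (fun x => a * g x) = a * cinner mu f g.
Proof.
move=> Lf Lg; have := cinner_lin a Lf Lg (isL2_0 mu).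
rewrite cinner0r addr0 => <-; congr cinner.
by apply/funext => x; rewrite addr0.
Qed.

(* Expand [0 <= |g - c f|^2] with [c = <f, g>]. *)
Lemma cinner_le f g : isL2 mu f -> isL2 mu g -> l2norm mu f <= 1 ->
  cmod (cinner mu f g) <= l2norm mu g.
Proof.
move=> Lf Lg f1; set c := cinner mu f g.
rewrite -(@ler_pXn2r _ 2) ?nnegrE ?l2norm_ge0 ?cmod_ge0// sqr_cmod.
have expand (k a b : R[i]) : sqmod (b + (- k) * a) =
    sqmod b + (- 2) * complex.Re (a^* * (k^* * b)) + sqmod k * sqmod a.
  by case: k => ? ?; case: a => ? ?; case: b => ? ?; rewrite /sqmod /=; ring.
have ReJ (k : R[i]) : complex.Re (k^* * k) = sqmod k.
  by case: k => ? ?; rewrite /sqmod /=; ring.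
have LZ := isL2Z c^* Lg.
have LB : isL2 mu (fun x => g x + (- c) * f x) by apply: isL2D => //; exact: isL2Z.
have rsq h : isL2 mu h -> Rintegral mu setT (fun x => sqmod (h x)) = l2norm mu h ^+ 2.
  by move=> Lh; rewrite /Rintegral l2norm_sqr.
have [iR _] := integrable_cinner Lf LZ.
have iZ (k : R) (u : R -> R) : mu.-integrable setT (EFin \o u) ->
    mu.-integrable setT (EFin \o (fun x => k * u x)).
  by move=> iu; have := integrableZl measurableT k iu; congr integrable.
have := sqr_ge0 (l2norm mu (fun x => g x + (- c) * f x)); rewrite -rsq//.
have -> : Rintegral mu setT (fun x => sqmod (g x + (- c) * f x)) =
  Rintegral mu setT (fun x => sqmod (g x) +
    (- 2) * complex.Re ((f x)^* * (c^* * g x)) + sqmod c * sqmod (f x)).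
  by apply: eq_Rintegral => x _; exact: expand.
have ig := integrable_sqmod Lg; have i_f := integrable_sqmod Lf.
rewrite RintegralD//; last 2 first.
- by have := integrableD measurableT ig (iZ (-2) _ iR); congr integrable.
- exact: iZ.
rewrite RintegralD//; last exact: iZ.
rewrite !RintegralZl// !rsq//.
have -> : Rintegral mu setT (fun x => complex.Re ((f x)^* * (c^* * g x))) = sqmod c.
  have : complex.Re (cinner mu f (fun x => c^* * g x)) = complex.Re (c^* * c).
    by rewrite cinnerZ.
  by rewrite ReJ.
(* The expansion reads 0 <= |g|^2 - 2 |c|^2 + |c|^2 |f|^2; with |f| <= 1 the last term is at most
   |c|^2, which leaves |c|^2 <= |g|^2. *)
have : sqmod c * l2norm mu f ^+ 2 <= sqmod c.
  by rewrite ler_piMr ?sqmod_ge0// expr_le1// l2norm_ge0.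
lra.
Qed.

Lemma isL2_cind (A : set R) : mu setT = 1%E -> measurable A ->
  isL2 mu (cind A) /\ l2norm mu (cind A) <= 1.
Proof.
move=> mu1 mA; apply: l2norm_le => //; first exact: cmeasurable_cind.
rewrite (@le_trans _ _ (\int[mu]_x (cst 1%E x))%E)//; last first.
  by rewrite integral_cst// mul1e mu1 expr1n.
apply: ge0_le_integral => //.
- by move=> x _; rewrite lee_fin sqmod_ge0.
- exact: cmeasurable_sqmod (cmeasurable_cind mA).
- move=> x _; rewrite lee_fin /sqmod /cind.
  by case: asboolP => _; rewrite /= !expr0n /= addr0 ?expr1n ?ler01.
Qed.

End InnerProduct.

(** * Self-similarity and measurability of the Cantor set *)

Section CantorGeometry.
Context {R : realType}.
Implicit Types (b c : bool) (x y : R) (w u : seq bool) (A : set R).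

Lemma SletterE b x : Sletter b x = (x + b%:R * 2) / 3.
Proof. by case: b; rewrite /= ?mul1r// mul0r addr0. Qed.

Lemma Sletter_inj b x y : Sletter b x = Sletter b y -> x = y.
Proof.
move=> h; have -> : x = 3 * Sletter b x - b%:R * 2 by rewrite SletterE; field.
by rewrite h SletterE; field.
Qed.

Lemma Sletter01 b x : 0 <= x <= 1 -> 0 <= Sletter b x <= 1.
Proof.
move=> /andP[x0 x1]; rewrite /Sletter /S0 /S2.
by case: b; apply/andP; split; lra.
Qed.

(** The first-level intervals [0,1/3] and [2/3,1] are disjoint. On the whole line both maps are
    onto, so the restriction to [0,1] is essential. *)
Lemma Sletter_disj b c x y : 0 <= x <= 1 -> 0 <= y <= 1 ->
  Sletter b x = Sletter c y -> b = c.
Proof.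
move=> /andP[x0 x1] /andP[y0 y1]; rewrite /Sletter /S0 /S2.
by case: b; case: c => // ?; lra.
Qed.

Lemma Sw01 w x : 0 <= x <= 1 -> 0 <= Sw w x <= 1.
Proof. by move=> x01; elim: w => //= b w ih; exact: Sletter01. Qed.

Lemma cantor01 x : cantor x -> 0 <= x <= 1.
Proof. by case/(_ 0%N) => w /size0nil -> [y /= y01 <-]; rewrite in_itv/= in y01. Qed.

Lemma cantor_nil : @cantor_w R [::] = @cantor R.
Proof. by rewrite /cantor_w /= image_id. Qed.

(** By disjointness of the branches, level n+1 for S_b x is level n for x. Level 0 of S_b x remains,
    and it only asks that the point lie in [0,1]. *)
Lemma cantor_Sletter b x : 0 <= x <= 1 ->
  cantor (Sletter b x) <-> cantor x.
Proof.
move=> x01; split=> [Cx n|Cx [|n]].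
- have [[//|c w] [sw]] := Cx n.+1; case=> y /=; rewrite in_itv/= => y01 eq.
  have cb := Sletter_disj (Sw01 w y01) x01 eq.
  exists w => //; exists y; first by rewrite /= in_itv.
  by rewrite cb in eq; exact: Sletter_inj eq.
- exists [::] => //; exists (Sletter b x) => //=; rewrite in_itv/=.
  exact: Sletter01.
- have [w sw [y y01 yx]] := Cx n.
  exists (b :: w); first by rewrite /= sw.
  by exists y => //=; rewrite yx.
Qed.

Lemma cantor_w_Sletter b c u x : 0 <= x <= 1 ->
  cantor_w (c :: u) (Sletter b x) <-> (b = c /\ cantor_w u x).
Proof.
move=> x01; split=> [[y Cy /= eq]|[-> [y Cy yx]]].
  have cb := Sletter_disj (Sw01 u (cantor01 Cy)) x01 eq; split => //.
  by rewrite cb in eq; exists y => //; exact: Sletter_inj eq.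
by exists y => //=; rewrite yx.
Qed.

Lemma measurable_Sletter b : measurable_fun setT (@Sletter R b).
Proof.
rewrite (_ : Sletter b = fun x => (x + b%:R * 2) / 3); last first.
  by apply/funext => x; rewrite SletterE.
apply: measurable_funM; last exact: measurable_cst.
by apply: measurable_funD; [exact: measurable_id|exact: measurable_cst].
Qed.

(** Each letter is an invertible affine map, so the image is a preimage under the inverse y -> 3 y -
    2 b. *)
Lemma measurable_Sw_image w A : measurable A -> measurable (Sw w @` A).
Proof.
move=> mA; elim: w => [|b w ih]; first by rewrite /= image_id.
have -> : Sw (b :: w) @` A = (fun y => 3 * y - b%:R * 2) @^-1` (Sw w @` A).
  apply/seteqP; split=> y /=.
    by move=> [x Ax <-]; exists x => //=; rewrite SletterE; field.
  by move=> [x Ax eq]; exists x => //=; rewrite SletterE eq; field.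
rewrite -[X in measurable X]setTI.
suff mf : measurable_fun setT (fun y : R => 3 * y - b%:R * 2) by exact: mf.
apply: measurable_funB; last exact: measurable_cst.
by apply: measurable_funM; [exact: measurable_cst|exact: measurable_id].
Qed.

Lemma measurable_cantor : measurable (@cantor R).
Proof.
(* Words are enumerated by natural numbers so that the union is countable. The default [[::]] at
   non-codes is harmless: it enters only at level 0, where it is the right word. *)
pose word k : seq bool := odflt [::] (unpickle k).
have -> : @cantor R =
    \bigcap_n \bigcup_(k in [set k | size (word k) = n]) (Sw (word k) @` `[0, 1]%classic).
  apply/seteqP; split => x.
    move=> Cx n _; have [w sw wx] := Cx n.
    by exists (pickle w); rewrite /word /mkset pickleK.
  by move=> Cx n; have [k sk kx] := Cx n I; exists (word k).
apply: bigcap_measurableType => n _; apply: bigcup_measurable => k _.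
by apply: measurable_Sw_image; exact: measurable_itv.
Qed.

Lemma measurable_cantor_w w : measurable (@cantor_w R w).
Proof. exact: measurable_Sw_image measurable_cantor. Qed.

End CantorGeometry.

(** * Integration against the self-similar measure *)

Section SelfSimilarMeasure.
Context {R : realType} (p : R) (mu : {measure set R -> \bar R}).
Hypothesis p01 : 0 < p < 1.
Hypothesis mu_out : mu (~` `[0, 1]%classic) = 0%E.
Hypothesis mu_selfsim : forall A : set R, measurable A ->
  mu A = (p%:E * mu (@S0 R @^-1` A) + (1 - p)%:E * mu (@S2 R @^-1` A))%E.

Definition letter_prob (b : bool) : R := if b then 1 - p else p.

Lemma letter_prob_gt0 b : 0 < letter_prob b.
Proof. by move: p01 => /andP[p0 p1]; case: b; rewrite /= ?subr_gt0. Qed.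

Lemma ae01 : {ae mu, forall x, 0 <= x <= 1}.
Proof.
exists (~` `[0, 1]%classic); split => //; apply: measurableC; exact: measurable_itv.
Qed.

(** Self-similarity says that [mu] is the sum of its two push-forwards scaled by the letter weights;
    the rest is change of variables. *)
Lemma ge0_integral_selfsim (f : R -> \bar R) : measurable_fun setT f ->
  (forall x, 0 <= f x)%E ->
  (\int[mu]_x f x = (letter_prob false)%:E * \int[mu]_x f (Sletter false x) +
                    (letter_prob true)%:E * \int[mu]_x f (Sletter true x))%E.
Proof.
move=> mf f0.
have mS b := @measurable_Sletter R b.
pose q b : {nonneg R} := NngNum (ltW (letter_prob_gt0 b)).
pose push b : {measure set R -> \bar R} :=
  measure_function_pushforward__canonical__measure_function_Measure mu (mS b).
pose nu b : {measure set R -> \bar R} := mscale (q b) (push b).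
rewrite (@eq_measure_integral _ _ _ setT (measure_add (nu false) (nu true))); last first.
  move=> A mA _; transitivity (nu false A + nu true A)%E.
    exact: mu_selfsim.
  by apply: esym; exact: measure_addE.
rewrite ge0_integral_measure_add//.
rewrite !ge0_integral_mscale//.
have f0' : {in [set: R], forall y, 0 <= f y}%E by move=> y _.
by rewrite !(ge0_integral_pushforward (mS _) mu measurableT mf f0').
Qed.

(** If N is null, the weighted sum of the measures of its two preimages is 0; as both weights are
    positive, each preimage is null. Hence almost everywhere identities may be composed with S_b. *)
Lemma ae_Sletter b (P : R -> Prop) : {ae mu, forall x, P x} ->
  {ae mu, forall x, P (Sletter b x)}.
Proof.
move=> [N [mN N0 PN]]; exists (Sletter b @^-1` N); split.
- by rewrite -[X in measurable X]setTI; exact: measurable_Sletter.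
- move: N0; rewrite mu_selfsim// => /eqP.
  rewrite padde_eq0 ?mule_ge0 ?lee_fin//; last 2 first.
    exact: ltW (letter_prob_gt0 false).
    exact: ltW (letter_prob_gt0 true).
  rewrite !mule_eq0 !eqe.
  rewrite (gt_eqF (letter_prob_gt0 false)) (gt_eqF (letter_prob_gt0 true)) /=.
  by move=> /andP[/eqP ? /eqP ?]; case: b.
- by move=> x /= nPx; apply: PN.
Qed.

Lemma cmeasurable_Sletter b (f : R -> R[i]) : cmeasurable f ->
  cmeasurable (f \o Sletter b).
Proof.
move=> [mr mi]; split.
  exact: (measurableT_comp mr (@measurable_Sletter R b)).
exact: (measurableT_comp mi (@measurable_Sletter R b)).
Qed.

(** One of the two nonnegative branches is dropped. Applied to |f|^2, it makes composition with S_b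
    bounded on L^2. *)
Lemma ge0_integral_Sletter_le b (f : R -> \bar R) : measurable_fun setT f ->
  (forall x, 0 <= f x)%E ->
  ((letter_prob b)%:E * \int[mu]_x f (Sletter b x) <= \int[mu]_x f x)%E.
Proof.
move=> mf f0; rewrite (ge0_integral_selfsim mf f0); case: b.
  by apply: leeDr; rewrite mule_ge0 ?lee_fin ?(ltW (letter_prob_gt0 false))// integral_ge0.
by apply: leeDl; rewrite mule_ge0 ?lee_fin ?(ltW (letter_prob_gt0 true))// integral_ge0.
Qed.

Lemma integrable_Sletter b (f : R -> \bar R) : mu.-integrable setT f ->
  mu.-integrable setT (f \o Sletter b).
Proof.
move=> /integrableP[mf foo]; apply/integrableP; split.
  exact: (measurableT_comp mf (@measurable_Sletter R b)).
have mabs : measurable_fun setT (fun x => `|f x|%E) by exact: measurableT_comp.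
have := ge0_integral_Sletter_le b mabs (fun x => abse_ge0 _).
rewrite -lee_pdivlMl ?letter_prob_gt0// => /le_lt_trans; apply.
by rewrite lte_mul_pinfty// lee_fin invr_ge0 ltW// letter_prob_gt0.
Qed.

Lemma Rintegral_selfsim (f : R -> R) : mu.-integrable setT (EFin \o f) ->
  Rintegral mu setT f =
  letter_prob false * Rintegral mu setT (f \o Sletter false) +
  letter_prob true * Rintegral mu setT (f \o Sletter true).
Proof.
move=> intf; pose F := EFin \o f.
have ip := integrable_funepos measurableT intf.
have im := integrable_funeneg measurableT intf.
rewrite /Rintegral -/F integralE.
rewrite (ge0_integral_selfsim (measurable_int _ ip))//.
rewrite (ge0_integral_selfsim (measurable_int _ im))//.
have split b : (\int[mu]_x (f (Sletter b x))%:E =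
    \int[mu]_x F^\+ (Sletter b x) - \int[mu]_x F^\- (Sletter b x))%E.
  rewrite integralE; congr (_ - _)%E.
    by rewrite -[(fun x => (f (Sletter b x))%:E)]/(F \o Sletter b) funepos_comp.
  by rewrite -[(fun x => (f (Sletter b x))%:E)]/(F \o Sletter b) funeneg_comp.
rewrite !split.
have fp b := integrable_fin_num measurableT (integrable_Sletter b ip).
have fm b := integrable_fin_num measurableT (integrable_Sletter b im).
rewrite -(fineK (fp false)) -(fineK (fp true)) -(fineK (fm false)) -(fineK (fm true)).
by rewrite /=; ring.
Qed.

Lemma isL2_Sletter b (f : R -> R[i]) : isL2 mu f ->
  isL2 mu (f \o Sletter b) /\
  letter_prob b * l2norm mu (f \o Sletter b) ^+ 2 <= l2norm mu f ^+ 2.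
Proof.
move=> Lf; have mf := isL2_cmeasurable Lf.
have L : isL2 mu (f \o Sletter b).
  have [mr mi] := cmeasurable_Sletter b mf; split => //.
  exact: (integrable_Sletter b (integrable_sqmod Lf)).
split => //; rewrite -lee_fin EFinM -!l2norm_sqr//.
apply: (@ge0_integral_Sletter_le b (fun x => (sqmod (f x))%:E)).
  exact: cmeasurable_sqmod.
by move=> x; rewrite lee_fin sqmod_ge0.
Qed.

Lemma cinner_selfsim (f g : R -> R[i]) : isL2 mu f -> isL2 mu g ->
  cinner mu f g =
  (letter_prob false)%:C * cinner mu (f \o Sletter false) (g \o Sletter false) +
  (letter_prob true)%:C * cinner mu (f \o Sletter true) (g \o Sletter true).
Proof.
move=> Lf Lg; have [ir ii] := integrable_cinner Lf Lg.
rewrite {1}/cinner (Rintegral_selfsim ir) (Rintegral_selfsim ii).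
by rewrite /cinner; apply/eqP; rewrite eq_complex /= !mul0r !subr0 !addr0 !eqxx.
Qed.

End SelfSimilarMeasure.

(** * How the operators K_m and their limit interact with the maps S_b *)

Section CantorOperator.
Context {R : realType} (p : R) (mu : {measure set R -> \bar R}).
Hypotheses (p01 : 0 < p < 1) (mu1 : mu setT = 1%E).
Hypothesis mu_out : mu (~` `[0, 1]%classic) = 0%E.
Hypothesis mu_selfsim : forall A : set R, measurable A ->
  mu A = (p%:E * mu (@S0 R @^-1` A) + (1 - p)%:E * mu (@S2 R @^-1` A))%E.

Local Notation q := (letter_prob p).

(** A nonempty word of length at most m+1 is a letter followed by a word of length at most m: the
    source of the index shift between K_(m+1) and K_m. *)
Lemma sum_words_le (V : nmodType) (F : seq bool -> V) m :
  \sum_(u <- words_le m.+1) F u = F [::] +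
    (\sum_(u <- words_le m) F (false :: u) + \sum_(u <- words_le m) F (true :: u)).
Proof.
rewrite /words_le (_ : iota 0 m.+2 = 0%N :: [seq n.+1 | n <- iota 0 m.+1]); last first.
  by rewrite -(iotaDl 1 0 m.+1).
move: (iota 0 m.+1) => s; rewrite map_cons [flatten _]/= big_cons; congr (_ + _).
rewrite -map_comp !big_flatten !big_map -big_split; apply: eq_bigr => n _ /=.
by rewrite cats0 big_cat !big_map.
Qed.

Lemma isL2_cantor_w u : isL2 mu (cind (@cantor_w R u)).
Proof. exact: (isL2_cind mu1 (measurable_cantor_w u)).1. Qed.

Lemma isL2_phi : isL2 mu (@phi R).
Proof. exact: (isL2_cind mu1 (@measurable_cantor R)).1. Qed.

Lemma phi_Sletter b (x : R) : 0 <= x <= 1 -> phi (Sletter b x) = phi x.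
Proof.
move=> x01; rewrite /phi /cind; do 2 case: asboolP => //.
  by move=> nC /(cantor_Sletter b x01).
by move=> C nC; case: nC; exact/(cantor_Sletter b x01).
Qed.

Lemma cind_cantor_w_Sletter b c u (x : R) : 0 <= x <= 1 ->
  cind (cantor_w (c :: u)) (Sletter b x) =
  if b == c then cind (cantor_w u) x else 0.
Proof.
move=> x01; rewrite /cind; case: asboolP => h.
  by have [-> Cx] := (cantor_w_Sletter b c u x01).1 h; rewrite eqxx asboolT.
case: eqP => // bc; rewrite asboolF// => Cx; apply: h.
exact: (cantor_w_Sletter b c u x01).2.
Qed.

Lemma cinner0l (f : R -> R[i]) : cinner mu (fun=> 0) f = 0.
Proof.
by rewrite /cinner; congr (_ +i* _); rewrite /Rintegral integral0_eq// => x _;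
   case: (f x) => ? ? /=; rewrite oppr0 !mul0r ?subr0 ?addr0.
Qed.

(** Self-similarity splits the integral into two branches. On branch c the indicator becomes that of
    C_u, and on the other it vanishes almost everywhere. *)
Lemma cinner_cantor_w c u (f : R -> R[i]) : isL2 mu f ->
  cinner mu (cind (cantor_w (c :: u))) f =
  (q c)%:C * cinner mu (cind (cantor_w u)) (f \o Sletter c).
Proof.
move=> Lf; rewrite (cinner_selfsim p01 mu_selfsim (isL2_cantor_w _) Lf).
have Lfb b := (isL2_Sletter p01 mu_selfsim b Lf).1.
have E b : cinner mu (cind (cantor_w (c :: u)) \o Sletter b) (f \o Sletter b) =
    if b == c then cinner mu (cind (cantor_w u)) (f \o Sletter c) else 0.
  transitivity (cinner mu (fun x => if b == c then cind (cantor_w u) x else 0)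
                          (f \o Sletter b)).
    apply: cinner_ae.
    - apply: cmeasurable_Sletter; exact: isL2_cmeasurable (isL2_cantor_w _).
    - case: (b == c); last exact: cmeasurable_cst.
      exact: isL2_cmeasurable (isL2_cantor_w u).
    - exact: isL2_cmeasurable (Lfb b).
    - exact: isL2_cmeasurable (Lfb b).
    - have := ae01 mu_out; apply: filterS => x x01 /=.
      exact: cind_cantor_w_Sletter.
    - exact: nearW.
  by case: eqP => [->//|_]; exact: cinner0l.
by rewrite !E; case: c {E}; rewrite /= mulr0 ?add0r ?addr0.
Qed.

(** The empty word produces the rank-one term, words starting with b produce q_b K_m (f o S_b), and
    words starting with the other letter vanish at S_b x. *)
Lemma Km_Sletter m b (f : R -> R[i]) (x : R) : isL2 mu f -> 0 <= x <= 1 ->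
  Km mu m.+1 f (Sletter b x) =
  cinner mu (@phi R) f * phi x + (q b)%:C * Km mu m (f \o Sletter b) x.
Proof.
move=> Lf x01; rewrite /Km sum_words_le; congr (_ + _).
  by rewrite cantor_nil -/(@phi R) phi_Sletter.
have E c : \sum_(u <- words_le m) cinner mu (cind (cantor_w (c :: u))) f *
      cind (cantor_w (c :: u)) (Sletter b x) =
    if b == c then (q b)%:C * \sum_(u <- words_le m)
      cinner mu (cind (cantor_w u)) (f \o Sletter b) * cind (cantor_w u) x else 0.
  under eq_bigr do rewrite cind_cantor_w_Sletter//.
  case: eqP => [->|_]; last by apply: big1 => u _; rewrite mulr0.
  by rewrite big_distrr; apply: eq_bigr => u _ /=; rewrite cinner_cantor_w// mulrA.
by rewrite !E; case: b {E}; rewrite /= ?add0r ?addr0.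
Qed.

Lemma ae_linear_Km m : ae_linear mu (Km mu m).
Proof.
split=> [f Lf|a f g Lf Lg].
  by apply: isL2_sum => u; apply: isL2Z; exact: isL2_cantor_w.
apply: nearW => x; rewrite /Km big_distrr -big_split; apply: eq_bigr => u _ /=.
by rewrite cinner_lin ?mulrDl ?mulrA//; exact: isL2_cantor_w.
Qed.

Lemma ae_linear_sub (S T : (R -> R[i]) -> R -> R[i]) :
  ae_linear mu S -> ae_linear mu T -> ae_linear mu (fun f x => S f x - T f x).
Proof.
move=> [LS lS] [LT lT]; split=> [f Lf|a f g Lf Lg].
  by apply: isL2B; [exact: LS|exact: LT].
have := lS a _ _ Lf Lg; have := lT a _ _ Lf Lg; apply: filterS2 => x -> ->.
ring.
Qed.

Variable K : (R -> R[i]) -> R -> R[i].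
Hypothesis lK : ae_linear mu K.
Hypothesis cvgK : (fun m => opnorm mu (fun f x => Km mu m f x - K f x)) @ \oo --> 0%E.

Lemma Km_cvg (f : R -> R[i]) : isL2 mu f ->
  (fun m => l2norm mu (fun x => Km mu m f x - K f x)) @ \oo --> (0 : R).
Proof.
(* Operator norms are extended reals; convergence to 0 makes them finite eventually, which suffices
   for the squeeze. *)
move=> Lf; have [ffin fcvg] := (fine_cvgP _ _).1 cvgK.
apply: (@squeeze_cvgr _ _ _ _ (cst 0)
  (fun m => fine (opnorm mu (fun f x => Km mu m f x - K f x)) * l2norm mu f)).
- move: ffin; apply: filterS => m fin; rewrite /= l2norm_ge0 /=.
  have lD := ae_linear_sub (ae_linear_Km m) lK.
  by apply: (l2norm_le_opnorm lD _ Lf); rewrite fineK.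
- exact: cvg_cst.
- rewrite -[X in _ --> X](mul0r (l2norm mu f)); apply: cvgMl.
  exact: fcvg.
Qed.

(** The sharp factor is the square root of q_b; since q_b^2 <= q_b, the weaker factor q_b avoids the
    root. *)
Lemma l2norm_Sletter_le b (f : R -> R[i]) : isL2 mu f ->
  q b * l2norm mu (f \o Sletter b) <= l2norm mu f.
Proof.
move=> Lf; have [_ le] := isL2_Sletter p01 mu_selfsim b Lf.
have q0 := letter_prob_gt0 p01 b.
rewrite -(@ler_pXn2r _ 2)// ?nnegrE ?mulr_ge0 ?(ltW q0) ?l2norm_ge0//.
apply: le_trans le; rewrite exprMn ler_wpM2r ?sqr_ge0//.
rewrite expr2 ler_piMr ?(ltW q0)//.
by move: p01 => /andP[? ?]; case: b {q0}; rewrite /=; lra.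
Qed.

Lemma K_Sletter b (f : R -> R[i]) : isL2 mu f -> {ae mu, forall x,
  K f (Sletter b x) =
  cinner mu (@phi R) f * phi x + (q b)%:C * K (f \o Sletter b) x}.
Proof.
move=> Lf; have [Lfb _] := isL2_Sletter p01 mu_selfsim b Lf.
have q0 := letter_prob_gt0 p01 b.
pose D m f x := Km mu m f x - K f x.
have LD m g : isL2 mu g -> isL2 mu (D m g).
  by move=> Lg; apply: (ae_linear_sub (ae_linear_Km m) lK).1.
pose c := cinner mu (@phi R) f.
pose E x := K f (Sletter b x) - (c * phi x + (q b)%:C * K (f \o Sletter b) x).
have LE : isL2 mu E.
  apply: isL2B; first exact: (isL2_Sletter p01 mu_selfsim b (lK.1 _ Lf)).1.
  by apply: isL2D; apply: isL2Z; [exact: isL2_phi|exact: lK.1].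
suff E0 : l2norm mu E = 0.
  have := l2norm_eq0 LE E0; apply: filterS => x.
  by rewrite /E => /eqP; rewrite subr_eq0 => /eqP.
(* [E] does not depend on m, yet by the exact relation for K_(m+1) it equals -(D_(m+1) f) o S_b +
   q_b D_m (f o S_b) on [0,1]. Both terms tend to 0 in norm. *)
have bd m : l2norm mu E <=
    (q b)^-1 * l2norm mu (D m.+1 f) + q b * l2norm mu (D m (f \o Sletter b)).
  have L1 := (isL2_Sletter p01 mu_selfsim b (LD m.+1 _ Lf)).1.
  have L2 := LD m _ Lfb.
  have -> : l2norm mu E = l2norm mu (fun x => -1 * (D m.+1 f \o Sletter b) x +
                                     (q b)%:C * D m (f \o Sletter b) x).
    apply: l2norm_ae.
    - exact: isL2_cmeasurable LE.
    - exact: isL2_cmeasurable (isL2D (isL2Z _ L1) (isL2Z _ L2)).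
    - have := ae01 mu_out; apply: filterS => x x01.
      by rewrite /E /D /= Km_Sletter// -/c; ring.
  apply: (le_trans (l2normD (isL2Z _ L1) (isL2Z _ L2))).
  rewrite !l2normZ// cmod_real ?(ltW q0)//.
  have -> : cmod (-1 : R[i]) = 1.
    by rewrite /cmod/= sqrrN expr1n oppr0 expr0n addr0 sqrtr1.
  rewrite mul1r lerD2r mulrC ler_pdivlMr// mulrC.
  exact: l2norm_Sletter_le (LD m.+1 _ Lf).
apply/eqP; rewrite eq_le l2norm_ge0 andbT.
have cv : (fun m => (q b)^-1 * l2norm mu (D m.+1 f) +
                    q b * l2norm mu (D m (f \o Sletter b))) @ \oo --> (0 : R).
  rewrite -[X in _ --> X](_ : (q b)^-1 * 0 + q b * 0 = 0); last first.
    by rewrite !mulr0 addr0.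
  apply: cvgD; apply: cvgMr; last exact: Km_cvg.
  have := Km_cvg Lf.
  by rewrite -(@cvg_shiftS _ (fun m => l2norm mu (D m f))).
have <- := cvg_lim (@Rhausdorff R) cv.
apply: limr_ge; first by apply/cvg_ex; eexists; exact: cv.
exact: nearW.
Qed.

End CantorOperator.

(** * The functional equation for m *)

Section ResolventFunctional.
Context {R : realType} (p : R) (mu : {measure set R -> \bar R}).
Variable K : (R -> R[i]) -> R -> R[i].
Hypotheses (p01 : 0 < p < 1) (mu1 : mu setT = 1%E).
Hypothesis mu_out : mu (~` `[0, 1]%classic) = 0%E.
Hypothesis mu_selfsim : forall A : set R, measurable A ->
  mu A = (p%:E * mu (@S0 R @^-1` A) + (1 - p)%:E * mu (@S2 R @^-1` A))%E.
Hypothesis lK : ae_linear mu K.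
Hypothesis cvgK : (fun m => opnorm mu (fun f x => Km mu m f x - K f x)) @ \oo --> 0%E.
Variables (M : R) (z : R[i]).
Hypothesis Mz : M + 1 < cmod z.
Hypothesis KM : forall f, isL2 mu f -> l2norm mu (K f) <= M * l2norm mu f.

Local Notation q := (letter_prob p).
Local Notation phi := (@phi R).

(** Dividing by q_b <= 1 does not decrease the modulus, so the one hypothesis on z covers all three
    spectral points. *)
Lemma cmod_letter_prob b : M + 1 < cmod (z / (q b)%:C).
Proof.
have q0 := letter_prob_gt0 p01 b.
apply: (lt_le_trans Mz).
have qC : (q b)%:C != 0 by rewrite eq_complex /= (gt_eqF q0).
have -> : cmod z = cmod (z / (q b)%:C) * q b.
  by have := cmodM (z / (q b)%:C) (q b)%:C; rewrite divfK// (cmod_real (ltW q0)).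
rewrite ler_piMr ?cmod_ge0//.
by move: p01 => /andP[? ?]; case: b {q0 qC}; rewrite /=; lra.
Qed.

(** The resolvent bound gives (|w| - M) |g| <= |phi| <= 1 with |w| - M > 1, so |g| < 1;
    Cauchy-Schwarz concludes. *)
Lemma resolvent_functional_lt1 w g : M + 1 < cmod w ->
  resolvent_sol mu K w g -> cmod (cinner mu phi g) < 1.
Proof.
move=> Mw [Lg eq].
have [Lphi phi1] := isL2_cind mu1 (@measurable_cantor R).
apply: (le_lt_trans (cinner_le Lphi Lg phi1)).
have := le_trans (resolvent_bound lK KM Lphi Lg eq) phi1.
rewrite ltNge => h; apply/negP => g1; move: h; apply/negP; rewrite -ltNge.
have d1 : 1 < cmod w - M by rewrite ltrBrDl.
apply: (lt_le_trans d1); rewrite ler_peMr// ltW//; exact: lt_trans d1.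
Qed.

(* Composing [z g - K g = phi] with [Sletter b] gives
   [(z / q b - K) (g \o Sletter b) = (1 + <phi, g>) / q b * phi]. *)
Lemma resolvent_functional_Sletter b g h : resolvent_sol mu K z g ->
  resolvent_sol mu K (z / (q b)%:C) h ->
  (q b)%:C * cinner mu phi (g \o Sletter b) =
  (1 + cinner mu phi g) * cinner mu phi h.
Proof.
move=> [Lg eqg] [Lh eqh].
have q0 := letter_prob_gt0 p01 b.
have qC : (q b)%:C != 0 by rewrite eq_complex /= (gt_eqF q0).
have Lphi := isL2_phi mu1.
have Lgb := (isL2_Sletter p01 mu_selfsim b Lg).1.
pose k := (1 + cinner mu phi g) / (q b)%:C.
pose D x := (g \o Sletter b) x - k * h x.
have Lkh : isL2 mu (fun x => k * h x) by exact: isL2Z.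
have LD : isL2 mu D by exact: isL2B.
have eqD : {ae mu, forall x, z / (q b)%:C * D x - K D x = 0}.
  have e1 := ae_linearB lK Lgb Lkh.
  have e2 := ae_linearZ k lK Lh.
  have e3 := K_Sletter p01 mu1 mu_out mu_selfsim lK cvgK b Lg.
  have e4 := ae_Sletter p01 mu_selfsim b eqg.
  have e5 := ae01 mu_out.
  near=> x.
  have -> : K D x = K (g \o Sletter b) x - k * K h x.
    have -> : K D x = K (g \o Sletter b) x - K (fun y => k * h y) x.
      by near: x; exact: e1.
    by congr (_ - _); near: x; exact: e2.
  have H3 : K g (Sletter b x) = cinner mu phi g * phi x + (q b)%:C * K (g \o Sletter b) x.
    by near: x; exact: e3.
  have H4 : z * g (Sletter b x) - K g (Sletter b x) = phi x.
    have -> : phi x = phi (Sletter b x).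
      by apply/esym/phi_Sletter; near: x; exact: e5.
    by near: x; exact: e4.
  have H5 : z / (q b)%:C * h x - K h x = phi x by near: x; exact: eqh.
  (* The relation for K g at S_b x and the resolvent equation for g there are combined to eliminate
     K g. With K h also eliminated, the claim is an identity of fractions. *)
  have H6 : (q b)%:C * K (g \o Sletter b) x =
      z * g (Sletter b x) - (1 + cinner mu phi g) * phi x.
    apply/eqP; rewrite -subr_eq0; apply/eqP.
    have -> : (q b)%:C * K (g \o Sletter b) x =
      K g (Sletter b x) - cinner mu phi g * phi x by rewrite H3; ring.
    by rewrite -[in X in _ - X](subrK (K g (Sletter b x)) (z * _)) H4; ring.
  have -> : K (g \o Sletter b) x =
      (z * g (Sletter b x) - (1 + cinner mu phi g) * phi x) / (q b)%:C.
    by rewrite -H6 mulrC mulKf.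
  have -> : K h x = z / (q b)%:C * h x - phi x by rewrite -H5; ring.
  by rewrite /D /k /=; field.
have D0 : l2norm mu D = 0.
  have := resolvent_bound lK KM (isL2_0 mu) LD eqD.
  rewrite l2norm0 => le0; apply/eqP; rewrite eq_le l2norm_ge0 andbT.
  rewrite -(@pmulr_rle0 _ (cmod (z / (q b)%:C) - M))// subr_gt0.
  by apply: lt_trans (cmod_letter_prob b); rewrite ltrDl.
have -> : cinner mu phi (g \o Sletter b) = cinner mu phi (fun x => k * h x).
  apply: cinner_ae; try exact: isL2_cmeasurable.
  - exact: isL2_cmeasurable Lphi.
  - exact: isL2_cmeasurable Lphi.
  - exact: isL2_cmeasurable Lgb.
  - exact: isL2_cmeasurable Lkh.
  - exact: nearW.
  - have := l2norm_eq0 LD D0; apply: filterS => x.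
    by rewrite /D => /eqP; rewrite subr_eq0 => /eqP.
by rewrite cinnerZ// /k; field.
Unshelve. all: by end_near. Qed.

(** Self-similarity splits <phi, g> into the q_b <phi o S_b, g o S_b>, and phi o S_b = phi almost
    everywhere. *)
Lemma resolvent_functional_eq g h0 h1 : resolvent_sol mu K z g ->
  resolvent_sol mu K (z / (q false)%:C) h0 ->
  resolvent_sol mu K (z / (q true)%:C) h1 ->
  cinner mu phi g =
  (1 + cinner mu phi g) * (cinner mu phi h0 + cinner mu phi h1).
Proof.
move=> sg s0 s1; have Lphi := isL2_phi mu1.
rewrite mulrDr -(resolvent_functional_Sletter sg s0).
rewrite -(resolvent_functional_Sletter sg s1).
rewrite [LHS](cinner_selfsim p01 mu_selfsim Lphi sg.1).
have E b : cinner mu (phi \o Sletter b) (g \o Sletter b) =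
           cinner mu phi (g \o Sletter b).
  have mgb := isL2_cmeasurable (isL2_Sletter p01 mu_selfsim b sg.1).1.
  have mphi := isL2_cmeasurable Lphi.
  apply: cinner_ae => //; first exact: cmeasurable_Sletter.
    by have := ae01 mu_out; apply: filterS => x; exact: phi_Sletter.
  exact: nearW.
by rewrite !E.
Qed.

End ResolventFunctional.

Theorem theorem7p1 (R : realType) (p : R) (mu : {measure set R -> \bar R})
    (Kinf : (R -> R[i]) -> (R -> R[i])) :
  0 < p < 1 ->
  (* mu = mu_p : Borel probability measure on [0,1], self-similar *)
  mu setT = 1%E ->
  mu (~` `[0, 1]%classic) = 0%E ->
  (forall A : set R, measurable A ->
     mu A = (p%:E * mu (@S0 R @^-1` A) + (1 - p)%:E * mu (@S2 R @^-1` A))%E) ->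
  (* K_infty = lim K_m in operator norm on L^2(mu_p) *)
  (forall f, isL2 mu f -> isL2 mu (Kinf f)) ->
  (forall (a : R[i]) f g, isL2 mu f -> isL2 mu g ->
     {ae mu, forall x, Kinf (fun y => a * f y + g y) x = a * Kinf f x + Kinf g x}) ->
  (fun m => opnorm mu (fun f x => Km mu m f x - Kinf f x)) @ \oo --> 0%E ->
  forall z : R[i], (opnorm mu Kinf + 1 < (cmod z)%:E)%E ->
  (forall w, w \in [:: z; z / p%:C; z / (1 - p)%:C] ->
     exists g, resolvent_sol mu Kinf w g) /\
  (forall g0 g1 g2,
     resolvent_sol mu Kinf z g0 ->
     resolvent_sol mu Kinf (z / p%:C) g1 ->
     resolvent_sol mu Kinf (z / (1 - p)%:C) g2 ->
     let m0 := cinner mu (@phi R) g0 in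
     let m1 := cinner mu (@phi R) g1 in
     let m2 := cinner mu (@phi R) g2 in
     m0 = m1 / (1 - m1) + m2 / ((1 - m1) * (1 - m1 - m2))).

Proof.
move=> p01 mu1 mu_out mu_selfsim LK lK cvgK z Mz.
have aK : ae_linear mu Kinf by [].
(* The strict inequality with |z| forces the operator norm to be finite. *)
have [M M0 KM] : exists2 M : R, 0 <= M & opnorm mu Kinf = M%:E.
  have n0 := opnorm_ge0 aK.
  move: Mz n0; case: (opnorm mu Kinf) => [M _ M0|//|//].
  by exists M => //; rewrite -lee_fin.
move: Mz; rewrite KM -EFinD lte_fin => Mz.
have bK f : isL2 mu f -> l2norm mu (Kinf f) <= M * l2norm mu f.
  by move=> Lf; apply: l2norm_le_opnorm => //; rewrite KM.
have Mb b : M + 1 < cmod (z / (letter_prob p b)%:C).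
  exact: cmod_letter_prob.
split=> [w wz|g0 g1 g2 s0 s1 s2 m0 m1 m2].
  have Mw : M < cmod w.
    apply: (@lt_trans _ _ (M + 1)); first by rewrite ltrDl.
    move: wz; rewrite !inE => /or3P[] /eqP-> //.
      exact: (Mb false).
    exact: (Mb true).
  have [g Lg eqg] := resolvent_exists aK M0 Mw bK (isL2_phi mu1).
  by exists g.
have eqm : m0 = (1 + m0) * (m1 + m2).
  exact: (resolvent_functional_eq p01 mu1 mu_out mu_selfsim aK cvgK Mz bK s0 s1 s2).
have m1n : 1 - m1 != 0.
  rewrite subr_eq0; apply/eqP => m11.
  have := resolvent_functional_lt1 mu1 aK bK (Mb false) s1.
  by rewrite -/m1 -m11 cmod1 ltxx.
(* The functional equation rearranges to (1 + m0) (1 - m1 - m2) = 1, so this factor cannot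
   vanish. *)
have m12n : 1 - m1 - m2 != 0.
  apply/eqP => e; have : (1 + m0) * (1 - m1 - m2) = 1.
    rewrite [RHS](_ : 1 = 1 + m0 - m0); last by rewrite addrK.
    by rewrite [X in _ = _ - X]eqm; ring.
  by rewrite e mulr0 => /esym/eqP; rewrite oner_eq0.
(* The numerator m1 (1 - m1 - m2) + m2 factors as (1 - m1) (m1 + m2), so 1 - m1 cancels. *)
have -> : m1 / (1 - m1) + m2 / ((1 - m1) * (1 - m1 - m2)) =
    (m1 + m2) / (1 - m1 - m2) by field; rewrite m12n m1n.
apply: (mulIf m12n); rewrite divfK//.
have -> : m0 * (1 - m1 - m2) = m0 - m0 * (m1 + m2) by ring.
by rewrite {1}eqm; ring.
Qed.
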